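(* Let $c<0$ and let $m>n\ge 1$ be integers. Let $$H^m(c)=\{(x_1,\dots,x_{n-1},x_n,\dots,x_{m-1},z)\in\mathbb{R}^m\mid z>0\},\quad g=-\frac{1}{cz^2}\Big(\sum_{k=1}^{m-1}dx_k^2+dz^2\Big),$$ $$H^n(c)=\{(x_1,\dots,x_{n-1},z)\in\mathbb{R}^n\mid z>0\},\quad h=-\frac{1}{cz^2}\Big(\sum_{i=1}^{n-1}dx_i^2+dz^2\Big).$$ Then the map $\phi:(H^m(c),g)\to(H^n(c),h)$ given by $$\phi(x_1,\dots,x_{n-1},x_n,\dots,x_{m-1},z)=(x_1,\dots,x_{n-1},z)$$ is a proper $\lambda$-biharmonic Riemannian submersion with $\lambda=2(n-1)c$.
   Context: For a smooth map $\phi:(M,g)\to(N,h)$, the tension field is $\tau(\phi)=\operatorname{tr}_g(\nabla d\phi)=\sum_i\{\nabla^\phi_{e_i}d\phi(e_i)-d\phi(\nabla^M_{e_i}e_i)\}$, and the bitension field is $$\tau_2(\phi)=\sum_i\Big\{\big(\nabla^{\phi}_{e_i}\nabla^{\phi}_{e_i}-\nabla^{\phi}_{\nabla^M_{e_i}e_i}\big)\tau(\phi)-R^N\bigl(d\phi(e_i),\tau(\phi)\bigr)d\phi(e_i)\Big\},$$ where $\{e_i\}$ is a local orthonormal frame of $M$, $\nabla^\phi$ is the induced connection on $\phi^{-1}TN$, and $R^N(X,Y)Z=\nabla^N_X\nabla^N_YZ-\nabla^N_Y\nabla^N_XZ-\nabla^N_{[X,Y]}Z$. For $\lambda\in\mathbb{R}$,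 a Riemannian submersion $\phi$ is $\lambda$-biharmonic if it is a critical point of $E_{2,\lambda}(\phi)=\frac12\int_M|\tau(\phi)|^2d\mu_g+\frac{\lambda}{2}\int_M|d\phi|^2d\mu_g$, i.e. if $\tau_{2,\lambda}(\phi):=\tau_2(\phi)-\lambda\tau(\phi)=0$. It is proper if in addition it is not harmonic, i.e. $\tau(\phi)\neq 0$. *)

(* Defs.v *)
(* Riemannian geometry on open subsets of R^m, in the global coordinates, on top
   of MathComp-Analysis.  A point and a tangent vector are both row vectors;
   a metric is a matrix-valued function (its Gram matrix in the frame d/dx_i). *)
From HB Require Import structures.
From mathcomp Require Import all_boot all_order all_algebra.
From mathcomp Require Import all_classical all_reals all_analysis.

Set Implicit Arguments.
Unset Strict Implicit.
Unset Printing Implicit Defensive.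

Import Order.TTheory GRing.Theory Num.Theory.
Import numFieldNormedType.Exports.

Local Open Scope classical_set_scope.
Local Open Scope ring_scope.

Section Calculus.
Variable R : realType.

Definition partial m (V : normedModType R) (i : 'I_m) (f : 'rV[R]_m -> V)
  : 'rV[R]_m -> V := fun x => 'D_(delta_mx 0 i) f x.

(* C^oo: every iterated partial derivative of f is Frechet differentiable (hence
   continuous) at every point of the open set U. *)
Definition smooth_on m (V : normedModType R) (U : set 'rV[R]_m)
    (f : 'rV[R]_m -> V) : Prop :=
  forall (s : seq 'I_m) (x : 'rV[R]_m), U x ->
    differentiable (foldr (@partial m V) f s) x.

(* dphi(X), a section of phi^{-1}TN; the directional derivative 'D_v phi x is
   the differential of phi at x applied to v as soon as phi is differentiable. *)
Definition push m n (phi : 'rV[R]_m -> 'rV[R]_n) (X : 'rV[R]_m -> 'rV[R]_m)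
  : 'rV[R]_m -> 'rV[R]_n := fun x => 'D_(X x) phi x.

End Calculus.

Section Metric.
Variables (R : realType) (m : nat).
Implicit Types (U : set 'rV[R]_m) (g : 'rV[R]_m -> 'M[R]_m).
Implicit Types (X Y Z : 'rV[R]_m -> 'rV[R]_m) (x u v w : 'rV[R]_m).

Definition inner g x u v : R := (u *m g x *m v^T) 0 0.

Definition riemannian_metric U g : Prop :=
  [/\ open U,
      smooth_on U g,
      forall x, U x -> (g x)^T = g x
    & forall x u, U x -> u != 0 -> 0 < inner g x u u].

(* The Christoffel symbol Gamma^k_{ij} of the Levi-Civita connection of g. *)
Definition christoffel g x (i j k : 'I_m) : R :=
  2^-1 * \sum_(l < m) invmx (g x) k l *
    (partial i (fun y => g y j l) x + partial j (fun y => g y i l) x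
     - partial l (fun y => g y i j) x).

Definition christoffel_form g x u v : 'rV[R]_m :=
  \row_k \sum_(i < m) \sum_(j < m) christoffel g x i j k * u 0 i * v 0 j.

(* nabla_X Y for the Levi-Civita connection of g. *)
Definition nabla g X Y : 'rV[R]_m -> 'rV[R]_m :=
  fun x => 'D_(X x) Y x + christoffel_form g x (X x) (Y x).

Definition lie_bracket X Y : 'rV[R]_m -> 'rV[R]_m :=
  fun x => 'D_(X x) Y x - 'D_(Y x) X x.

Definition curvature g X Y Z : 'rV[R]_m -> 'rV[R]_m :=
  fun x => nabla g X (nabla g Y Z) x - nabla g Y (nabla g X Z) x
           - nabla g (lie_bracket X Y) Z x.

(* R(u, v)w for tangent vectors at x: the curvature is tensorial, so u, v, w may
   be extended to arbitrary vector fields, here the constant ones. *)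
Definition curvature_at g x u v w : 'rV[R]_m :=
  curvature g (fun=> u) (fun=> v) (fun=> w) x.

Definition orthonormal_frame g (W : set 'rV[R]_m)
    (e : 'I_m -> 'rV[R]_m -> 'rV[R]_m) : Prop :=
  [/\ open W,
      forall i, smooth_on W (e i)
    & forall x, W x -> forall i j, inner g x (e i x) (e j x) = (i == j)%:R].

End Metric.

Section Maps.
Variables (R : realType) (m n : nat).
Implicit Types (U : set 'rV[R]_m) (V : set 'rV[R]_n).
Implicit Types (g : 'rV[R]_m -> 'M[R]_m) (h : 'rV[R]_n -> 'M[R]_n).
Implicit Types (phi : 'rV[R]_m -> 'rV[R]_n).
Implicit Types (e : 'I_m -> 'rV[R]_m -> 'rV[R]_m).

Definition horizontal g phi (x u : 'rV[R]_m) : Prop :=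
  forall v, 'D_v phi x = 0 -> inner g x u v = 0.

(* As in O'Neill's definition, a Riemannian submersion is onto. *)
Definition riemannian_submersion U g V h phi : Prop :=
  [/\ riemannian_metric U g /\ riemannian_metric V h,
      smooth_on U phi,
      phi @` U = V,
      forall x, U x -> forall w : 'rV[R]_n, exists v, 'D_v phi x = w
    & forall x, U x -> forall u v, horizontal g phi x u -> horizontal g phi x v ->
        inner h (phi x) ('D_u phi x) ('D_v phi x) = inner g x u v].

(* nabla^phi_X S for a section S of phi^{-1}TN: the pull-back by phi of the
   Levi-Civita connection of h. *)
Definition nabla_along h phi (X : 'rV[R]_m -> 'rV[R]_m) (S : 'rV[R]_m -> 'rV[R]_n)
  : 'rV[R]_m -> 'rV[R]_n :=
  fun x => 'D_(X x) S x + christoffel_form h (phi x) (push phi X x) (S x).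

(* tau(phi) on the domain of the local orthonormal frame e. *)
Definition tension g h phi e : 'rV[R]_m -> 'rV[R]_n :=
  fun x => \sum_(i < m)
    (nabla_along h phi (e i) (push phi (e i)) x
     - push phi (nabla g (e i) (e i)) x).

(* tau_2(phi) on the domain of the local orthonormal frame e. *)
Definition bitension g h phi e : 'rV[R]_m -> 'rV[R]_n :=
  let tau := tension g h phi e in
  fun x => \sum_(i < m)
    (nabla_along h phi (e i) (nabla_along h phi (e i) tau) x
     - nabla_along h phi (nabla g (e i) (e i)) tau x
     - curvature_at h (phi x) (push phi (e i) x) (tau x) (push phi (e i) x)).

(* tau(phi) and tau_2(phi) do not depend on the frame, and every point has a
   neighbourhood carrying one; a pointwise equation on U is required to hold in
   every local orthonormal frame. *)
Definition harmonic U g h phi : Prop :=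
  forall (W : set 'rV[R]_m) e, W `<=` U -> orthonormal_frame g W e ->
    forall x, W x -> tension g h phi e x = 0.

(* The Euler-Lagrange equation tau_2(phi) - lambda tau(phi) = 0 of E_{2,lambda}. *)
Definition lambda_biharmonic U g h phi (lambda : R) : Prop :=
  forall (W : set 'rV[R]_m) e, W `<=` U -> orthonormal_frame g W e ->
    forall x, W x ->
      bitension g h phi e x - lambda *: tension g h phi e x = 0.

Definition proper_lambda_biharmonic_submersion U g V h phi (lambda : R) : Prop :=
  [/\ riemannian_submersion U g V h phi,
      lambda_biharmonic U g h phi lambda
    & ~ harmonic U g h phi].

End Maps.

Section HyperbolicSpace.
Variable R : realType.

(* The last coordinate z of a point of R^m (0 in the degenerate case m = 0). *)
Definition height m : 'rV[R]_m -> R :=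
  match m with
  | 0 => fun=> 0
  | k.+1 => fun x : 'rV[R]_k.+1 => x 0 ord_max
  end.

Definition half_space m : set 'rV[R]_m := [set x | 0 < height x].

(* - 1/(c z^2) times the Euclidean metric. *)
Definition hyperbolic_metric m (c : R) (x : 'rV[R]_m) : 'M[R]_m :=
  (- (c * height x ^+ 2)^-1)%:M.

(* (x_1, .., x_(m-1), z) |-> (x_1, .., x_(n-1), z). *)
Definition hyperbolic_projection m n (le_nm : (n <= m)%N) (x : 'rV[R]_m)
  : 'rV[R]_n :=
  \row_(j < n) if j.+1 == n then height x else x 0 (widen_ord le_nm j).

End HyperbolicSpace.

Arguments half_space : clear implicits.

(* Main.v *)
(* Write k = -c, z for the height, E for the last basis vector and P for the matrix
   of the linear map phi.  The Christoffel form of the hyperbolic metric is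
   -(1/z) B(u, v) with B(u, v) = v_z u + u_z v - (u . v) E, and an orthonormal frame
   is a Euclidean tight frame: sum_i e_i^T e_i = k z^2 I; so is its image under P.
   Hence tau = beta z E with beta = (m - n) c.  This gives
   nabla^phi_X tau = beta (X_z E - X P), whose dependence on X is linear with
   constant coefficients, so the derivatives of the frame cancel in tau_2.
   The rough Laplacian and the curvature term (curvature c) each contribute
   (n - 1) c tau, whence tau_2 = 2 (n - 1) c tau. *)
Require Import Defs.
From HB Require Import structures.
From mathcomp Require Import all_boot all_order all_algebra.
From mathcomp Require Import all_classical all_reals all_analysis.
From mathcomp Require Import ring zify.
Import Order.TTheory GRing.Theory Num.Theory.
Import numFieldNormedType.Exports.
Local Open Scope ring_scope.

Set Implicit Arguments.
Unset Strict Implicit.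
Unset Printing Implicit Defensive.

(** * Derivatives of germs, linear maps and scalings *)

Lemma near_eq_differentiable (R : realType) (V W : normedModType R)
    (f g : V -> W) (x : V) :
  (\near x, f x = g x) -> differentiable f x -> differentiable g x.
Proof.
move=> fg df.
have [dc dfE] := (diff_locallyP x f).1 df.
have dgE : g \o shift x = cst (g x) + 'd f x +o_ (0 : V) id.
  apply/eqaddoP => eps eps0.
  move/eqaddoP: dfE => /(_ eps eps0).
  (* The differential of [f] serves for [g]: the two remainders agree near 0, because [f] and [g]
     agree near [x] and at [x] itself. *)
  have fg0 : \forall y \near (0 : V), f (y + x) = g (y + x).
    by move: fg; rewrite (near_shift 0 x)/= subr0.
  rewrite -(nbhs_singleton fg) => H.
  near=> y.
  have -> : (g \o shift x - (cst (f x) + 'd f x)) y =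
      (f \o shift x - (cst (f x) + 'd f x)) y.
    by rewrite !fctE /= (near fg0 y).
  by near: y.
apply/diff_locallyP.
by rewrite (diff_unique dc dgE).
Unshelve. all: by end_near. Qed.

Section MatrixCalculus.
Variable R : realType.

Lemma mulmxr_differentiable m n (Q : 'M[R]_(m, n)) x :
  differentiable (fun y : 'rV[R]_m => y *m Q) x.
Proof.
rewrite (_ : (fun _ => _) = \sum_i (fun y : 'rV[R]_m => y 0 i *: row i Q)).
  apply: differentiable_sum => i.
  by apply: differentiableZl; exact: differentiable_coord.
by apply/funext => y; rewrite mulmx_sum_row fct_sumE.
Qed.

Lemma derive_mulmxr m n p (f : 'rV[R]_m -> 'rV[R]_n) (Q : 'M[R]_(n, p)) x v :
  differentiable f x -> 'D_v (fun y => f y *m Q) x = 'D_v f x *m Q.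
Proof.
move=> df.
have dQ y : differentiable (mulmxr Q : 'rV[R]_n -> 'rV[R]_p) y.
  exact: mulmxr_differentiable.
have cQ : continuous (mulmxr Q : 'rV[R]_n -> 'rV[R]_p).
  by move=> y; apply: differentiable_continuous.
rewrite (_ : (fun _ => _) = mulmxr Q \o f)//.
rewrite !deriveE//; last exact: differentiable_comp.
by rewrite diff_comp//= diff_lin.
Qed.

Lemma derive_linear m n (Q : 'M[R]_(m, n)) x v :
  'D_v (fun y : 'rV[R]_m => y *m Q) x = v *m Q.
Proof. by rewrite (@derive_mulmxr _ _ _ id) ?derive_id. Qed.

Lemma derive_coord m i (x v : 'rV[R]_m) :
  'D_v (fun y : 'rV[R]_m => y 0 i) x = v 0 i.
Proof.
have := @derive_mx R _ 1 m id x v (@derivable_id _ _ _ _).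
by rewrite derive_id => /rowP /(_ i); rewrite mxE => ->.
Qed.

Lemma derive_scalel m (W : normedModType R) (k : 'rV[R]_m -> R) (A : W) x v :
  differentiable k x -> 'D_v (fun y => k y *: A) x = 'D_v k x *: A.
Proof.
by move=> dk; rewrite !deriveE// ?diffZl//; exact: differentiableZl.
Qed.

End MatrixCalculus.

(** * Smoothness: inverse powers of the height, and linear maps *)

Section Height.
Variables (R : realType) (m : nat).
Implicit Types (x y v : 'rV[R]_m.+1).

Lemma height_differentiable x : differentiable (@height R m.+1) x.
Proof. exact: differentiable_coord. Qed.

Lemma invpow_height_differentiable p x :
  height x != 0 -> differentiable (fun y => (height y ^+ p)^-1) x.
Proof.
move=> zx0; apply: differentiableV; last by rewrite expf_neq0.
case: p => [|p]; first exact: differentiable_cst.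
by have := differentiableX p (height_differentiable x); rewrite exprfctE.
Qed.

Lemma derive_invpow_height p x v : height x != 0 ->
  'D_v (fun y => (height y ^+ p)^-1) x =
    - p%:R * height v / height x ^+ p.+1.
Proof.
move=> zx0.
have dz : derivable (@height R m.+1) x v.
  exact/diff_derivable/height_differentiable.
have dzp : derivable (@height R m.+1 ^+ p) x v by exact: derivableX.
have zp0 : (@height R m.+1 ^+ p) x != 0 by rewrite exprfctE expf_neq0.
have := deriveV zp0 dzp.
(* The case [p = 0] is separate because the predecessor of the exponent in the power rule is
   truncated there. *)
rewrite deriveX// derive_coord exprfctE => ->; case: p {dzp zp0} => [|p] /=.
  by rewrite !(mul0r, scale0r, scaler0, oppr0, mulr0).
rewrite /GRing.scale/= !exprS !invfM; field.
by rewrite zx0 expf_neq0.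
Qed.

Lemma half_space_open : open (half_space R m.+1).
Proof.
rewrite /half_space; apply: (@open_comp _ _ (@height R m.+1) [set r | 0 < r]).
  by move=> x _; exact/differentiable_continuous/height_differentiable.
exact: open_gt.
Qed.

(** Constant multiples of inverse powers of the height are stable under partial derivatives. The
    closed form holds only on the half-space, which is open, so it may be differentiated at each of
    its points. *)
Lemma smooth_invpow_height (V : normedModType R) (A : V) p
    (f : 'rV[R]_m.+1 -> V) :
  (forall x, half_space R m.+1 x -> f x = (height x ^+ p)^-1 *: A) ->
  smooth_on (half_space R m.+1) f.
Proof.
move=> fE s.
suff: exists q B, forall x, half_space R m.+1 x ->
    foldr (@partial R m.+1 V) f s x = (height x ^+ q)^-1 *: B.
  move=> [q [B H]] x Ux; apply: (@near_eq_differentiable _ _ _ _ _ _ _).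
    near=> y; apply/esym/H; near: y; exact: (open_nbhs_nbhs (conj half_space_open Ux)).
  apply: differentiableZl; apply: invpow_height_differentiable.
  by rewrite gt_eqF.
elim: s => [|i s [q [B H]]] /=; first by exists p, A.
exists q.+1, ((- q%:R * height (delta_mx 0 i : 'rV[R]_m.+1)) *: B) => x Ux.
rewrite /partial (near_eq_derive (g := fun y => (height y ^+ q)^-1 *: B)).
  have z0 : height x != 0 by rewrite gt_eqF.
  rewrite derive_scalel ?derive_invpow_height//; last exact: invpow_height_differentiable.
  by rewrite scalerA mulrC.
near=> y; apply: H; near: y; exact: (open_nbhs_nbhs (conj half_space_open Ux)).
Unshelve. all: by end_near. Qed.

End Height.

Lemma smooth_affine (R : realType) m n (U : set 'rV[R]_m) (Q : 'M[R]_(m, n)) :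
  smooth_on U (fun x => x *m Q).
Proof.
move=> s x _.
suff [B [C ->]] : exists B C, foldr (@partial R m _) (fun x => x *m Q) s =
    (fun x => x *m B + C).
  apply: differentiableD; first exact: mulmxr_differentiable.
  exact: differentiable_cst.
elim: s => [|i s [B [C H]]] /=.
  by exists Q, 0; apply/funext => y; rewrite addr0.
exists 0, (delta_mx 0 i *m B); apply/funext => y.
rewrite mulmx0 add0r /partial H deriveD; last 2 first.
- exact/diff_derivable/mulmxr_differentiable.
- exact/derivable_cst.
by rewrite derive_linear derive_cst addr0.
Qed.

(** * Euclidean dot product and tight frames *)

Section DotProduct.
Variables (R : realType) (m : nat).
Implicit Types u v w : 'rV[R]_m.

Definition dot u v : R := (u *m v^T) 0 0.

Lemma dotE u v : dot u v = \sum_i u 0 i * v 0 i.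
Proof. by rewrite /dot mxE; apply: eq_bigr => i _; rewrite mxE. Qed.

Lemma dotC u v : dot u v = dot v u.
Proof. by rewrite !dotE; apply: eq_bigr => i _; rewrite mulrC. Qed.

Lemma dotDr u v w : dot u (v + w) = dot u v + dot u w.
Proof. by rewrite /dot linearD mulmxDr mxE. Qed.

Lemma dotZr a u v : dot u (a *: v) = a * dot u v.
Proof. by rewrite /dot linearZ -scalemxAr mxE. Qed.

Lemma dotNr u v : dot u (- v) = - dot u v.
Proof. by rewrite -scaleN1r dotZr mulN1r. Qed.

Lemma dot_gt0 u : u != 0 -> 0 < dot u u.
Proof.
move=> /rV0Pn[i ui0]; rewrite dotE (bigD1 i)//=.
rewrite ltr_pwDl ?sumr_ge0//; first by rewrite -expr2 exprn_even_gt0.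
by move=> j _; rewrite -expr2 sqr_ge0.
Qed.

End DotProduct.

(** Entrywise form of sum_i f_i^T f_i = s I. The number [p] of vectors is independent of the
    dimension, since projecting a frame of R^m gives m vectors of R^n. *)
Definition tight_frame (R : realType) p m (s : R) (f : 'I_p -> 'rV[R]_m) :=
  forall a b, \sum_i f i 0 a * f i 0 b = s * (a == b)%:R.

Section TightFrame.
Variables (R : realType) (p m : nat) (s : R) (f : 'I_p -> 'rV[R]_m).
Hypothesis f_tight : tight_frame s f.

Lemma tight_frame_expand w : \sum_i dot (f i) w *: f i = s *: w.
Proof.
apply/rowP => k; rewrite summxE mxE.
under eq_bigr => i _ do rewrite mxE dotE mulr_suml.
rewrite exchange_big (bigD1 k)//= [X in _ + X]big1 => [|a /negPf ak].
  rewrite addr0; under eq_bigr => i _ do rewrite mulrAC.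
  by rewrite -mulr_suml f_tight eqxx mulr1.
under eq_bigr => i _ do rewrite mulrAC.
by rewrite -mulr_suml f_tight ak mulr0 mul0r.
Qed.

Lemma tight_frame_dot : \sum_i dot (f i) (f i) = s * m%:R.
Proof.
under eq_bigr => i _ do rewrite dotE.
rewrite exchange_big (eq_bigr (fun=> s)) => [|a _].
  by rewrite sumr_const card_ord mulr_natr.
by rewrite f_tight eqxx mulr1.
Qed.

End TightFrame.

Arguments height : simpl never.

(** * Connection, curvature and orthonormal frames of the hyperbolic half-space *)

Section HyperbolicConnection.
Variables (R : realType) (m : nat).
Implicit Types u v w x : 'rV[R]_m.+1.

Definition north : 'rV[R]_m.+1 := delta_mx 0 ord_max.

Lemma dot_north u : dot u north = height u.
Proof.
rewrite dotE (bigD1 ord_max)//= big1 => [|i /negPf im].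
  by rewrite mxE !eqxx mulr1 addr0.
by rewrite mxE im andbF mulr0.
Qed.

Lemma heightD u v : height (u + v) = height u + height v.
Proof. by rewrite /height mxE. Qed.

Lemma heightZ a u : height (a *: u) = a * height u.
Proof. by rewrite /height mxE. Qed.

Lemma heightN u : height (- u) = - height u.
Proof. by rewrite /height mxE. Qed.

Lemma height_north : height north = 1 :> R.
Proof. by rewrite /height mxE !eqxx. Qed.

(* Minus [height] times the Christoffel form of the hyperbolic metric. *)
Definition hyp_form u v := height v *: u + height u *: v - dot u v *: north.

Lemma hyp_formZr a u v : hyp_form u (a *: v) = a *: hyp_form u v.
Proof.
by rewrite /hyp_form heightZ dotZr !scalerDr scalerN !scalerA (mulrC (height u)).
Qed.

Variable c : R.
Hypothesis c0 : c != 0.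

Lemma partial_hyperbolic_metric x i j l : height x != 0 ->
  partial i (fun y => hyperbolic_metric c y j l) x =
    2 * (i == ord_max)%:R * (j == l)%:R / (c * height x ^+ 3).
Proof.
move=> z0; rewrite /partial.
have -> : (fun y => hyperbolic_metric c y j l) =
    (fun y => (height y ^+ 2)^-1 *: (- c^-1 * (j == l)%:R : R)).
  apply/funext => y; rewrite mxE -mulr_natr invfM /GRing.scale/=; ring.
rewrite derive_scalel; last exact: invpow_height_differentiable.
rewrite derive_invpow_height// /height mxE eqxx/= (eq_sym ord_max) /GRing.scale/=.
by field; rewrite c0 z0.
Qed.

(** The metric is conformal to the Euclidean one, and half the logarithmic derivative of the factor
    is -1/z along the last axis. The inverse metric is diagonal, so only l = k contributes, and [c]
    cancels against it. *)
Lemma christoffel_hyperbolic x i j k : height x != 0 ->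
  christoffel (hyperbolic_metric c) x i j k =
    - (height x)^-1 * ((i == ord_max)%:R * (j == k)%:R
      + (j == ord_max)%:R * (i == k)%:R - (k == ord_max)%:R * (i == j)%:R).
Proof.
move=> z0; rewrite /christoffel (bigD1 k)//= big1 => [|l lk].
  rewrite !partial_hyperbolic_metric// /hyperbolic_metric invmx_scalar mxE eqxx.
  by rewrite mulr1n invrN invrK; field; rewrite c0 z0.
by rewrite /hyperbolic_metric invmx_scalar mxE eq_sym (negPf lk) mulr0n mul0r.
Qed.

Lemma christoffel_form_hyperbolic x u v : height x != 0 ->
  christoffel_form (hyperbolic_metric c) x u v = (height x)^-1 *: - hyp_form u v.
Proof.
have sum_delta (F : 'I_m.+1 -> R) k : \sum_j (j == k)%:R * F j = F k.
  rewrite (bigD1 k)//= eqxx mul1r big1 ?addr0// => j /negPf ->.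
  by rewrite mul0r.
move=> z0; apply/rowP => k; rewrite mxE.
have row_sum i : \sum_j christoffel (hyperbolic_metric c) x i j k * u 0 i * v 0 j =
    - (height x)^-1 * ((i == ord_max)%:R * u 0 i * v 0 k
     + (i == k)%:R * u 0 i * height v - (k == ord_max)%:R * (u 0 i * v 0 i)).
  (* Entries of [v] are expanded into sums over j against Kronecker deltas, so that both sides
     compare term by term. *)
  rewrite -[v 0 k](sum_delta (v 0)) -[height v](sum_delta (v 0)).
  rewrite -[v 0 i](sum_delta (v 0)) !mulr_sumr -big_split -sumrB.
  rewrite mulr_sumr; apply: eq_bigr => j _ /=.
  by rewrite christoffel_hyperbolic// (eq_sym j i); ring.
under eq_bigr => i _ do rewrite row_sum.
rewrite -mulr_sumr sumrB big_split /= -!mulr_suml -mulr_sumr -dotE !sum_delta.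
rewrite /hyp_form !mxE eqxx /= /height.
ring.
Qed.

Lemma nabla_cst_hyperbolic x u (X : 'rV[R]_m.+1 -> 'rV[R]_m.+1) :
  height x != 0 -> nabla (hyperbolic_metric c) (fun=> u) X x =
    'D_u X x - (height x)^-1 *: hyp_form u (X x).
Proof. by move=> z0; rewrite /nabla christoffel_form_hyperbolic// scalerN. Qed.

(** The exponent 1 is kept so that [derive_invpow_height] applies at the next differentiation. *)
Lemma nabla_cst_cst_hyperbolic x u v : height x != 0 ->
  nabla (hyperbolic_metric c) (fun=> u) (fun=> v) x =
    (height x ^+ 1)^-1 *: - hyp_form u v.
Proof.
move=> z0; rewrite nabla_cst_hyperbolic// (derive_cst v) add0r scalerN.
by rewrite expr1.
Qed.

(** The first term comes from differentiating 1/z, the second from applying the Christoffel form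
    twice. *)
Lemma nabla2_cst_hyperbolic x u v w : half_space R m.+1 x ->
  nabla (hyperbolic_metric c) (fun=> u)
    (nabla (hyperbolic_metric c) (fun=> v) (fun=> w)) x =
  (height x ^+ 2)^-1 *: (height u *: hyp_form v w + hyp_form u (hyp_form v w)).
Proof.
move=> Ux; have z0 : height x != 0 by rewrite gt_eqF.
rewrite nabla_cst_hyperbolic// nabla_cst_cst_hyperbolic//.
rewrite (near_eq_derive (g := fun y => (height y ^+ 1)^-1 *: - hyp_form v w)).
  rewrite derive_scalel; last exact: invpow_height_differentiable.
  rewrite derive_invpow_height// -[- hyp_form v w]scaleN1r !hyp_formZr.
  rewrite [RHS]scalerDr !scalerA -[X in _ + X]scaleNr.
  by congr (_ *: _ + _ *: _); field.
near=> y; apply: nabla_cst_cst_hyperbolic; rewrite gt_eqF//.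
near: y; exact: (open_nbhs_nbhs (conj (@half_space_open R m) Ux)).
Unshelve. all: by end_near. Qed.

(* Constant curvature [c]: the metric is [-1/(c z^2)] times the dot product. *)
Lemma curvature_at_hyperbolic x u v w : half_space R m.+1 x ->
  curvature_at (hyperbolic_metric c) x u v w =
    - (height x ^+ 2)^-1 *: (dot v w *: u - dot u w *: v).
Proof.
move=> Ux; have z0 : height x != 0 by rewrite gt_eqF.
rewrite /curvature_at /curvature !nabla2_cst_hyperbolic//.
(* Constant fields commute, so the bracket term reduces to [hyp_form 0 w], which vanishes. *)
have -> : lie_bracket (fun=> u) (fun=> v) = fun=> 0 :> 'rV[R]_m.+1.
  by apply/funext => y; rewrite /lie_bracket !derive_cst subrr.
rewrite nabla_cst_cst_hyperbolic// -scalerBr.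
apply/rowP => k.
rewrite /hyp_form !(dotDr, dotNr, dotZr, heightD, heightN, heightZ) dot_north.
rewrite height_north (dotC v u) !dot_north.
have -> : dot (0 : 'rV[R]_m.+1) w = 0 by rewrite /dot mul0mx mxE.
have -> : height (0 : 'rV[R]_m.+1) = 0 by rewrite /height mxE.
rewrite !mxE !eqxx /=.
by ring.
Qed.

End HyperbolicConnection.

(** Let A be the square matrix with rows e_i. Orthonormality says that A^T is a right inverse of
    s^-1 A; it is then also a left inverse, which is tightness. *)
Lemma orthonormal_tight (R : realType) m (s : R) (e : 'I_m -> 'rV[R]_m) :
  s != 0 -> (forall i j, s^-1 * dot (e i) (e j) = (i == j)%:R) ->
  tight_frame s e.
Proof.
move=> s0 He a b.
pose A : 'M[R]_m := \matrix_(i, j) e i 0 j.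
have AAT : (s^-1 *: A) *m A^T = 1%:M.
  apply/matrixP => i j; rewrite -scalemxAl !mxE -He dotE; congr (_ * _).
  by apply: eq_bigr => k _; rewrite !mxE.
have /matrixP /(_ a b) := mulmx1C AAT.
rewrite -scalemxAr !mxE => /(congr1 (fun r => s * r)).
rewrite mulrA mulfV// mul1r => <-.
by apply: eq_bigr => i _; rewrite !mxE.
Qed.

Lemma inner_hyperbolic (R : realType) (c : R) m (x u v : 'rV[R]_m) :
  inner (hyperbolic_metric c) x u v = (- (c * height x ^+ 2))^-1 * dot u v.
Proof. by rewrite /inner mul_mx_scalar -scalemxAl mxE invrN. Qed.

Lemma hyperbolic_riemannian (R : realType) (c : R) m : c < 0 ->
  riemannian_metric (half_space R m.+1) (hyperbolic_metric c).
Proof.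
move=> c_lt0; split.
- exact: half_space_open.
- apply: (@smooth_invpow_height _ _ _ (- c^-1)%:M 2) => x _.
  by rewrite scale_scalar_mx /hyperbolic_metric invfM mulrN mulrC.
- by move=> x _; exact: tr_scalar_mx.
- move=> x u Ux u0; rewrite inner_hyperbolic mulr_gt0 ?dot_gt0//.
  by rewrite invr_gt0 -mulNr mulr_gt0 ?oppr_gt0 ?exprn_gt0.
Qed.

(** * The projection as a linear Riemannian submersion *)

Section Projection.
Variables (R : realType) (M N : nat) (le_NM : (N.+1 <= M.+1)%N).
Implicit Types (x u v : 'rV[R]_M.+1) (w : 'rV[R]_N.+1).

Let phi := @hyperbolic_projection R M.+1 N.+1 le_NM.

Definition kept_coord (j : 'I_N.+1) : 'I_M.+1 :=
  if j.+1 == N.+1 then ord_max else widen_ord le_NM j.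

Lemma kept_coord_max : kept_coord ord_max = ord_max.
Proof. by rewrite /kept_coord eqxx. Qed.

(** A widened index other than the last is below N, hence below M, so it never meets [ord_max]. *)
Lemma kept_coord_inj : injective kept_coord.
Proof.
move=> i j; rewrite /kept_coord !eqSS; have := ltn_ord i; have := ltn_ord j.
move=> jN iN; case: eqP => iE; case: eqP => jE /(congr1 val) /= ijE;
  apply: val_inj => /=; lia.
Qed.

Definition proj_mx : 'M[R]_(M.+1, N.+1) := \matrix_(i, j) (i == kept_coord j)%:R.

Lemma mul_proj_mx u j : (u *m proj_mx) 0 j = u 0 (kept_coord j).
Proof.
rewrite mxE (bigD1 (kept_coord j))//= mxE eqxx mulr1 big1 ?addr0// => i.
by move=> /negPf ij; rewrite mxE ij mulr0.
Qed.

Lemma hyperbolic_projectionE : phi = fun x => x *m proj_mx.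
Proof.
apply/funext => x; apply/rowP => j; rewrite mul_proj_mx mxE /kept_coord.
by case: ifP.
Qed.

(** Thus w P^T is a preimage of w under P; it supplies both the points and the tangent vectors
    needed for surjectivity. *)
Lemma proj_mx_tr_mul : proj_mx^T *m proj_mx = 1%:M.
Proof.
apply/row_matrixP => i; apply/rowP => j; rewrite row_mul mul_proj_mx !mxE.
by rewrite (inj_eq kept_coord_inj) eq_sym.
Qed.

Lemma height_proj u : height (u *m proj_mx) = height u.
Proof. by rewrite /height mul_proj_mx kept_coord_max. Qed.

Lemma north_proj : north R M *m proj_mx = north R N.
Proof.
apply/rowP => j; rewrite mul_proj_mx !mxE -kept_coord_max.
by rewrite (inj_eq kept_coord_inj).
Qed.

Lemma derive_proj x v : 'D_v phi x = v *m proj_mx.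
Proof. by rewrite hyperbolic_projectionE derive_linear. Qed.

Lemma push_proj (X : 'rV[R]_M.+1 -> 'rV[R]_M.+1) :
  push phi X = fun x => X x *m proj_mx.
Proof. by apply/funext => x; rewrite /push derive_proj. Qed.

Lemma tight_frame_proj p s (f : 'I_p -> 'rV[R]_M.+1) :
  tight_frame s f -> tight_frame s (fun i => f i *m proj_mx).
Proof.
move=> ft a b; under eq_bigr => i _ do rewrite !mul_proj_mx.
by rewrite ft (inj_eq kept_coord_inj).
Qed.

Lemma projection_submersion (c : R) : c < 0 ->
  riemannian_submersion (half_space R M.+1) (hyperbolic_metric c)
    (half_space R N.+1) (hyperbolic_metric c) phi.
Proof.
move=> c_lt0; split.
- by split; exact: hyperbolic_riemannian.
- by rewrite hyperbolic_projectionE; exact: smooth_affine.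
- rewrite hyperbolic_projectionE; apply/seteqP; split=> [_ [x Ux <-]|w Uw] /=.
    by rewrite /half_space /= height_proj.
  exists (w *m proj_mx^T); last by rewrite -mulmxA proj_mx_tr_mul mulmx1.
  by rewrite /half_space /= -height_proj -mulmxA proj_mx_tr_mul mulmx1.
- move=> x _ w; exists (w *m proj_mx^T).
  by rewrite derive_proj -mulmxA proj_mx_tr_mul mulmx1.
- move=> x Ux u v hu _; rewrite !inner_hyperbolic !derive_proj.
  rewrite hyperbolic_projectionE height_proj.
  have k0 : (- (c * height x ^+ 2))^-1 != 0.
    by rewrite invr_eq0 oppr_eq0 mulf_eq0 expf_eq0/= (lt_eqF c_lt0) gt_eqF.
  (* Testing the horizontal [u] against the vertical part of [v] gives u . v = u . (v P P^T) = (u P)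
     . (v P). *)
  have /hu/eqP : 'D_(v - v *m proj_mx *m proj_mx^T) phi x = 0.
    by rewrite derive_proj mulmxBl -!mulmxA proj_mx_tr_mul mulmx1 subrr.
  rewrite inner_hyperbolic mulf_eq0 (negPf k0)/= dotDr dotNr subr_eq0.
  move=> /eqP ->; congr (_ * _).
  by rewrite /dot !trmx_mul trmxK !mulmxA.
Qed.

End Projection.

(** * Traces over a tight frame *)

Section FrameSums.
Variables (R : realType) (p m : nat) (s : R) (f : 'I_p -> 'rV[R]_m.+1).
Hypothesis f_tight : tight_frame s f.

(** Each summand is 2 f_z f - |f|^2 E; the dimension is m + 1, so the sum is (2 - (m + 1)) s E. *)
Lemma sum_hyp_form :
  \sum_i hyp_form (f i) (f i) = (s * (1 - m%:R)) *: north R m.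
Proof.
rewrite /hyp_form sumrB big_split/= -scaler_suml (tight_frame_dot f_tight).
under eq_bigr => i _ do rewrite -dot_north.
rewrite (tight_frame_expand f_tight) -scalerDl -scalerBl; congr (_ *: _).
by rewrite -natr1; ring.
Qed.

(** The vector f_z E - f has height 0, so each summand is |f|^2 E - f_z f. This trace occurs in the
    rough Laplacian of tau. *)
Lemma sum_hyp_form_vertical :
  \sum_i hyp_form (f i) (height (f i) *: north R m - f i) = (s * m%:R) *: north R m.
Proof.
transitivity (\sum_i (dot (f i) (f i) *: north R m - height (f i) *: f i)).
  apply: eq_bigr => i _.
  rewrite /hyp_form heightD heightZ heightN height_north dotDr dotNr dotZr.
  rewrite dot_north mulr1 subrr scale0r add0r scalerBr scalerA.
  by rewrite scalerBl opprB addrC addrA subrK.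
rewrite sumrB -scaler_suml (tight_frame_dot f_tight).
under [X in _ - X]eq_bigr => i _ do rewrite -dot_north.
rewrite (tight_frame_expand f_tight) -scalerBl; congr (_ *: _).
by rewrite -natr1; ring.
Qed.

(** For s = -c z^2 the value is - m c w, minus the Ricci operator in dimension m + 1. *)
Lemma sum_curvature_at_hyperbolic c x w : c != 0 -> half_space R m.+1 x ->
  \sum_i curvature_at (hyperbolic_metric c) x (f i) w (f i) =
    (s * m%:R / height x ^+ 2) *: w.
Proof.
move=> c0 Ux; under eq_bigr => i _ do rewrite curvature_at_hyperbolic//.
rewrite -scaler_sumr sumrB -scaler_suml (tight_frame_dot f_tight).
under eq_bigr => i _ do rewrite dotC.
rewrite (tight_frame_expand f_tight) -scalerBl scalerA; congr (_ *: _).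
by rewrite -natr1; ring.
Qed.

End FrameSums.

(** * Tension and bitension fields of the projection *)

Section TensionFields.
Variables (R : realType) (c : R) (M N : nat) (le_NM : (N.+1 <= M.+1)%N).
Hypothesis c_lt0 : c < 0.

Let phi := @hyperbolic_projection R M.+1 N.+1 le_NM.
Let P := proj_mx R le_NM.
Let g := @hyperbolic_metric R M.+1 c.
Let h := @hyperbolic_metric R N.+1 c.
Let beta := (M%:R - N%:R) * c.

Let c0 : c != 0. Proof. by rewrite lt_eqF. Qed.

Lemma orthonormal_hyperbolic_tight W e x :
  orthonormal_frame g W e -> W x -> half_space R M.+1 x ->
  tight_frame (- (c * height x ^+ 2)) (e ^~ x).
Proof.
move=> [_ _ eo] Wx Ux; apply: orthonormal_tight => [|i j].
  by rewrite oppr_eq0 mulf_eq0 expf_eq0/= (negPf c0) gt_eqF.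
by rewrite -inner_hyperbolic eo.
Qed.

Lemma nabla_along_projection X S x : half_space R M.+1 x ->
  nabla_along h phi X S x =
    'D_(X x) S x - (height x)^-1 *: hyp_form (X x *m P) (S x).
Proof.
move=> Ux; rewrite /nabla_along push_proj /phi hyperbolic_projectionE.
by rewrite (christoffel_form_hyperbolic c0) ?height_proj ?gt_eqF// scalerN.
Qed.

Lemma nabla_hyperbolic X Y x : half_space R M.+1 x ->
  nabla g X Y x = 'D_(X x) Y x - (height x)^-1 *: hyp_form (X x) (Y x).
Proof.
by move=> Ux; rewrite /nabla (christoffel_form_hyperbolic c0) ?gt_eqF// scalerN.
Qed.

Variables (W : set 'rV[R]_M.+1) (e : 'I_M.+1 -> 'rV[R]_M.+1 -> 'rV[R]_M.+1).
Hypothesis WU : (W `<=` half_space R M.+1)%classic.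
Hypothesis e_on : orthonormal_frame g W e.

Let e_diff i x : W x -> differentiable (e i) x.
Proof. by case: e_on => _ es _ Wx; exact: (es i [::] x Wx). Qed.

Lemma tension_projection x : W x ->
  tension g h phi e x = height x *: (beta *: north R N).
Proof.
move=> Wx; have Ux := WU Wx; have z0 : height x != 0 by rewrite gt_eqF.
have et := orthonormal_hyperbolic_tight e_on Wx Ux.
(* As phi is linear, the derivatives of the frame cancel and only the Christoffel terms remain. *)
transitivity (- (height x)^-1 *: (\sum_i hyp_form (e i x *m P) (e i x *m P)
    - (\sum_i hyp_form (e i x) (e i x)) *m P)).
  rewrite mulmx_suml -sumrB scaler_sumr; apply: eq_bigr => i _.
  rewrite nabla_along_projection// !push_proj nabla_hyperbolic//.
  rewrite derive_mulmxr; last exact: e_diff.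
  rewrite mulmxBl -scalemxAl opprB addrC addrA subrK.
  by rewrite -scalerBr scaleNr -[RHS]scalerN; congr (_ *: _); rewrite [RHS]opprB.
rewrite (sum_hyp_form (tight_frame_proj le_NM et)) (sum_hyp_form et).
rewrite -scalemxAl north_proj -scalerBl !scalerA; congr (_ *: _).
by rewrite /beta; field.
Qed.

Lemma nabla_along_tension X x : W x ->
  nabla_along h phi X (tension g h phi e) x =
    beta *: (height (X x) *: north R N - X x *m P).
Proof.
move=> Wx; have Ux := WU Wx; have z0 : height x != 0 by rewrite gt_eqF.
rewrite nabla_along_projection// tension_projection//.
rewrite (near_eq_derive (g := fun y => height y *: (beta *: north R N))).
  rewrite derive_scalel; last exact: height_differentiable.
  rewrite derive_coord !hyp_formZr !scalerA mulKf//.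
  (* Here B(u, E) = u, because u . E = u_z. *)
  rewrite /hyp_form height_north dot_north height_proj scale1r addrK.
  by rewrite scalerBr scalerA (mulrC beta).
near=> y; apply: tension_projection; near: y.
by apply: open_nbhs_nbhs; split=> //; case: e_on.
Unshelve. all: by end_near. Qed.

(** Matrix of the map from X to nabla^phi_X tau. *)
Let Q : 'M[R]_(M.+1, N.+1) := beta *: ((north R M)^T *m north R N - P).

Let mulQE u : u *m Q = beta *: (height u *: north R N - u *m P).
Proof.
rewrite /Q -scalemxAr mulmxBr mulmxA; congr (_ *: (_ - _)).
by rewrite [u *m _]mx11_scalar -/(dot _ _) dot_north mul_scalar_mx.
Qed.

Lemma bitension_projection x : W x ->
  bitension g h phi e x = (2 * N%:R * c) *: tension g h phi e x.
Proof.
move=> Wx; have Ux := WU Wx; have z0 : height x != 0 by rewrite gt_eqF.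
have et := orthonormal_hyperbolic_tight e_on Wx Ux.
have ft := tight_frame_proj le_NM et.
have nabla2E i : nabla_along h phi (e i)
    (nabla_along h phi (e i) (tension g h phi e)) x =
    'D_(e i x) (e i) x *m Q
    - (height x)^-1 *: hyp_form (e i x *m P) (e i x *m Q).
  rewrite nabla_along_projection// nabla_along_tension// -mulQE.
  rewrite (near_eq_derive (g := fun y => e i y *m Q)).
    by rewrite derive_mulmxr//; exact: e_diff.
  near=> y; rewrite nabla_along_tension ?mulQE//; near: y.
  by apply: open_nbhs_nbhs; split=> //; case: e_on.
(* The terms D_{e_i} e_i Q cancel between the second derivative and the correction along nabla_{e_i}
   e_i. *)
transitivity ((height x)^-1 *: ((\sum_i hyp_form (e i x) (e i x)) *m Q
    - \sum_i hyp_form (e i x *m P) (e i x *m Q))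
    - \sum_i curvature_at h (phi x) (e i x *m P) (tension g h phi e x) (e i x *m P)).
  rewrite mulmx_suml -sumrB scaler_sumr -sumrB; apply: eq_bigr => i _.
  rewrite nabla2E nabla_along_tension// -mulQE nabla_hyperbolic// push_proj.
  congr (_ - _); rewrite mulmxBl -scalemxAl [RHS]scalerBr opprB addrC addrA.
  by rewrite subrK.
(* The first trace is a multiple of E, and E Q = 0 because P sends E to E. *)
rewrite (sum_hyp_form et) -scalemxAl mulQE height_north scale1r north_proj.
rewrite subrr scaler0 scaler0 add0r.
under eq_bigr => i _ do rewrite mulQE hyp_formZr -[height (e i x)](height_proj le_NM).
rewrite -scaler_sumr (sum_hyp_form_vertical ft).
have hphi : height (phi x) = height x.
  by rewrite /phi hyperbolic_projectionE height_proj.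
rewrite (sum_curvature_at_hyperbolic ft) ?hphi//; last first.
  by rewrite /half_space /= hphi.
(* With s = -c z^2, the remaining trace and the curvature trace each contribute N c tau. *)
rewrite tension_projection// scalerN -opprD !scalerA -scalerDl -[LHS]scaleNr.
congr (_ *: _).
by field.
Unshelve. all: by end_near. Qed.

End TensionFields.

(** * A global orthonormal frame, and the conclusion *)

(** This is the frame sqrt(-c) z d/dx_i, written as a linear map of [x] so that [smooth_affine]
    gives its smoothness. Since [harmonic] quantifies over frames, refuting it requires one. *)
Lemma hyperbolic_orthonormal_frame (R : realType) (c : R) m : c < 0 ->
  orthonormal_frame (hyperbolic_metric c) (half_space R m.+1)
    (fun i x => x *m (Num.sqrt (- c) *: ((north R m)^T *m delta_mx 0 i))).
Proof.
move=> c_lt0; split; first exact: half_space_open.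
  by move=> i; exact: smooth_affine.
move=> x Ux i j; rewrite inner_hyperbolic /dot.
have eE k : x *m (Num.sqrt (- c) *: ((north R m)^T *m delta_mx 0 k)) =
    (Num.sqrt (- c) * height x) *: delta_mx 0 k.
  rewrite -scalemxAr mulmxA [x *m _]mx11_scalar -/(dot _ _) dot_north.
  by rewrite mul_scalar_mx scalerA.
rewrite !eE [X in _ *m X]linearZ/= -scalemxAl. rewrite -scalemxAr scalerA mxE trmx_delta.
rewrite mul_delta_mx_cond mulmxnE mxE !eqxx.
have : height x != 0 by rewrite gt_eqF.
have c0 : c != 0 by rewrite lt_eqF.
have := sqr_sqrtr (ltW (_ : 0 < - c)); rewrite oppr_gt0 => /(_ c_lt0) rE z0.
rewrite mulrACA -!expr2 rE; case: (i == j) => /=; last by rewrite !mulr0.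
by field; rewrite c0 z0.
Qed.

Unset Implicit Arguments.
Set Strict Implicit.

Theorem mainTheorem2 (R : realType) (c : R) (m n : nat)
    (hc : c < 0) (hn : (1 <= n)%N) (hnm : (n < m)%N) :
  proper_lambda_biharmonic_submersion
    (half_space R m) (hyperbolic_metric c)
    (half_space R n) (hyperbolic_metric c)
    (hyperbolic_projection (ltnW hnm)) (2 * (n%:R - 1) * c).
Proof.
case: n hn hnm => [//|N] _; case: m => [//|M] hNM; split.
- exact: projection_submersion.
- move=> W e WU e_on x Wx.
  rewrite (bitension_projection _ hc WU e_on)// -scalerBl.
  by rewrite -[N.+1%:R]natr1 addrK subrr scale0r.
move=> /(_ _ _ (@subset_refl _ _) (hyperbolic_orthonormal_frame M hc)).
(* At this point the height is 1 and the tension is (M - N) c E, whose height is nonzero because N <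
   M and c < 0. *)
move=> /(_ (north R M)).
have U1 : half_space R M.+1 (north R M) by rewrite /half_space /= height_north.
move=> /(_ U1); 
rewrite (tension_projection _ hc _ (hyperbolic_orthonormal_frame M hc))//.
move=> /(congr1 (@height R N.+1)).
rewrite !heightZ !height_north [height 0]/height mxE => /eqP.
rewrite mul1r mulr1 mulf_eq0 (lt_eqF hc) orbF subr_eq0 eqr_nat.
by rewrite gtn_eqF.
Qed.
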